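(* Let $\mathcal{G}=\{(y_1,a_1),\dots,(y_K,a_K)\}\subseteq\mathcal{Y}\rtimes\mathbb{Z}^n$ and let $\Gamma$ be a $\mathcal{G}$-graph that is symmetric, face-accessible and $\mathbb{Z}^n$-generating. Then there exist $z_1,\dots,z_m\in\mathbb{Z}^n$ such that the union of translations $\widehat\Gamma=\bigcup_{i=1}^m(\Gamma+z_i)$ is an Eulerian graph.
   Context: A $\mathcal{G}$-graph is a finite directed multigraph whose vertex set $V(\Gamma)$ is a finite subset of $\mathbb{Z}^n$ (each vertex incident to an edge), with each edge $e$ (from $s(e)$ to $d(e)$) labeled $\ell(e)\in\{1,\dots,K\}$ and satisfying $d(e)=s(e)+a_{\ell(e)}$. $\Gamma$ is symmetric if at every vertex in-degree equals out-degree; Eulerian if it has an Euler circuit (equivalently symmetric and connected). $\Gamma$ is $\mathbb{Z}^n$-generating if $\{d(e)-s(e): e\in E(\Gamma)\}$ generates $\mathbb{Z}^n$ as a semigroup. Let $C$ be the convex hull of $V(\Gamma)$; a strict face $F$ of $C$ (a nonempty face different from $C$) is accessible if some edge $e$ has $s(e)\in F$ and $d(e)\notin F$; $\Gamma$ is face-accessible if every strict face of $C$ is accessible. The translation $\Gamma+z$ moves all vertices and edges by $z\in\mathbb{Z}^n$ keeping labels; the union $\bigcup_i(\Gamma+z_i)$ is the multigraph whose edge multiset is the sum of the edge multisets of the $\Gamma+z_i$. *)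

(* Defs.v *)
From HB Require Import structures.
From mathcomp Require Import all_boot all_order all_algebra.
From mathcomp Require Import classical_sets reals.
Set Implicit Arguments. Unset Strict Implicit. Unset Printing Implicit Defensive.
Import Order.TTheory GRing.Theory Num.Theory.
Local Open Scope ring_scope.
Local Open Scope classical_set_scope.

(* Points of Z^n are row vectors 'rV[int]_n.
   The generating set G = {(y_i, a_i)} is represented by its translation parts
   a : 'I_K -> 'rV[int]_n (the Y-components play no role in the statement).
   An edge is a pair (source, label); its destination is source + a label.
   A G-graph is a finite multiset of edges, represented by a seq (order
   irrelevant); its vertex set is the set of sources and destinations. *)
Definition edge (n K : nat) := ('rV[int]_n * 'I_K)%type.

Section GGraph.
Variables (n K : nat) (a : 'I_K -> 'rV[int]_n).

Definition src (e : edge n K) : 'rV[int]_n := e.1.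
Definition lbl (e : edge n K) : 'I_K := e.2.
Definition dst (e : edge n K) : 'rV[int]_n := e.1 + a e.2.

Definition vertices (E : seq (edge n K)) : seq 'rV[int]_n :=
  undup (map src E ++ map dst E).

Definition symmetric_graph (E : seq (edge n K)) : Prop :=
  forall v : 'rV[int]_n,
    count (fun e => src e == v) E = count (fun e => dst e == v) E.

Definition eulerian (E : seq (edge n K)) : Prop :=
  exists s : seq (edge n K),
    perm_eq s E /\ cycle (fun e f => dst e == src f) s.

Definition Zn_generating (E : seq (edge n K)) : Prop :=
  forall z : 'rV[int]_n, exists s : seq (edge n K),
    [/\ s != [::], all (fun e => e \in E) s &
        z = \sum_(e <- s) (dst e - src e)].

Definition translate (z : 'rV[int]_n) (E : seq (edge n K)) : seq (edge n K) :=
  map (fun e => (src e + z, lbl e)) E.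

Definition union_translates (E : seq (edge n K)) (zs : seq 'rV[int]_n)
  : seq (edge n K) := flatten (map (fun z => translate z E) zs).

Variable R : realType.

Definition toR (v : 'rV[int]_n) : 'rV[R]_n := map_mx (fun x : int => x%:~R) v.

Definition dotR (c x : 'rV[R]_n) : R := \sum_(i < n) c 0 i * x 0 i.

Definition conv_hull (V : seq 'rV[int]_n) : set 'rV[R]_n :=
  [set x | exists w : 'I_(size V) -> R,
     [/\ forall i, 0 <= w i, \sum_i w i = 1 &
         x = \sum_i w i *: toR (nth 0 V i)]].

(* faces of a convex set C (polytope convention): intersections of C with a
   supporting hyperplane {c.x = c0} where c.x <= c0 on C (this includes C and
   the empty set). *)
Definition is_face (C F : set 'rV[R]_n) : Prop :=
  exists (c : 'rV[R]_n) (c0 : R),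
    (forall x, C x -> dotR c x <= c0) /\ F = C `&` [set x | dotR c x = c0].

Definition face_accessible (E : seq (edge n K)) : Prop :=
  let C := conv_hull (vertices E) in
  forall F : set 'rV[R]_n, is_face C F -> F !=set0 -> F <> C ->
    exists2 e, e \in E & F (toR (src e)) /\ ~ F (toR (dst e)).

End GGraph.

(* Main.v *)
Require Import Defs.
From HB Require Import structures.
From mathcomp Require Import all_boot all_order all_algebra.
From mathcomp Require Import boolp classical_sets reals zify.
Set Implicit Arguments. Unset Strict Implicit. Unset Printing Implicit Defensive.
Import Order.TTheory GRing.Theory Num.Theory.

(** Translate the graph by all sums of [N] vertices (with repetition), [N] large.
    A vertex of the union is the sum of a configuration of [N + 1] chips placed on
    the vertices of the graph, and an edge can be followed from that sum as soon
    as its source holds a chip. Some vertex holds many chips. If the set [A] of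
    heavy vertices does not consist of all the vertices in some face, Farkas'
    lemma over the rationals gives an integer relation which turns chips on [A]
    into chips on a new vertex without changing the sum; if it does, and the face
    is strict, accessibility gives an edge along which chips can be pushed out of
    [A]. So every configuration is connected to one with many chips everywhere.
    From there a chip may be carried from any vertex to any other, since the
    difference is a sum of boundedly many edge vectors; hence the union is
    connected. As it is also balanced, it has an Euler circuit. *)

(** * Euler circuits of balanced connected multigraphs *)

Section EulerCircuit.
Variables (T D : eqType) (s d : D -> T).

Definition balanced (E : seq D) :=
  forall v, count (fun e => s e == v) E = count (fun e => d e == v) E.

(** Phrased through predicates rather than paths, so that for the union of translates connectedness
    becomes a statement about predicates invariant under chip moves. *)
Definition weakly_connected (E : seq D) := forall P : pred T,
  {in E, forall e, P (s e) = P (d e)} ->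
  {in E &, forall e f, P (s e) -> P (s f)}.

Let follows e f := d e == s f.

(** Each inner vertex of a trail is entered as often as it is left, so only the two ends need a
    correction. *)
Lemma count_path e p v : path follows e p ->
  count (fun f => s f == v) (e :: p) + (d (last e p) == v) =
  count (fun f => d f == v) (e :: p) + (s e == v).
Proof.
elim: p e => [|f p IHp] e /=; first by rewrite !addn0 addnC.
case/andP=> /eqP def_f /IHp /=; rewrite def_f; lia.
Qed.

Lemma balanced_cycle c : cycle follows c -> balanced c.
Proof.
case: c => // e p; rewrite /= rcons_path => /andP[/count_path cp /eqP last_p] v.
by have := cp v; rewrite last_p => /eqP; rewrite eqn_add2r => /eqP.
Qed.

Lemma balanced_cat_cycle E c r :
  perm_eq E (c ++ r) -> balanced E -> cycle follows c -> balanced r.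
Proof.
move=> /permP pE bE /balanced_cycle bc v.
have := bE v; rewrite !pE !count_cat bc => /eqP.
by rewrite eqn_add2l => /eqP.
Qed.

(** A trail that is not closed enters its end once more than it leaves it. Since [E] is balanced,
    some edge of [r] leaves that end; appending it shortens [r]. *)
Lemma closed_trail_extend E e p r : balanced E -> perm_eq E ((e :: p) ++ r) ->
  path follows e p ->
  exists p' r', perm_eq E ((e :: p') ++ r') /\ cycle follows (e :: p').
Proof.
have [m] := ubnP (size r).
elim: m p r => // m IHm p r le_r bE pE path_p.
have [last_p|/negbTE last_p] := boolP (d (last e p) == s e).
  by exists p, r; split; rewrite //= rcons_path path_p.
pose v := d (last e p).
have : has (fun f => s f == v) r.
  rewrite has_count; have := bE v; rewrite !(permP pE) !count_cat.
  have := count_path v path_p; rewrite /v eqxx [s e == _]eq_sym last_p; lia.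
case/hasP=> f f_r /eqP s_f; have pr := perm_to_rem f_r.
apply: (IHm (rcons p f) (rem f r)) => //.
- by rewrite size_rem //; case: (r) f_r le_r.
- rewrite (perm_trans pE) // -cats1 -cat_cons -catA perm_cat2l /=.
  exact: pr.
- by rewrite rcons_path path_p /follows s_f /=.
Qed.

Lemma closed_trail E e : balanced E -> e \in E ->
  exists p r, perm_eq E ((e :: p) ++ r) /\ cycle follows (e :: p).
Proof.
move=> bE e_E; apply: (closed_trail_extend (p := [::]) (r := rem e E)) => //.
by rewrite /= perm_to_rem.
Qed.

Lemma cycle_splice e p q f : s e = s f ->
  cycle follows (e :: p) -> cycle follows (f :: q) ->
  cycle follows ((e :: p) ++ f :: q).
Proof.
move=> ef /=; rewrite !rcons_path cat_path /= last_cat /= /follows.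
by rewrite -ef => /andP[-> ->] /andP[-> ->].
Qed.

Theorem euler_circuit E : balanced E -> weakly_connected E ->
  exists c, perm_eq c E /\ cycle follows c.
Proof.
move=> bE cE.
suff: forall m c r, size r < m -> perm_eq E (c ++ r) -> cycle follows c ->
    exists c', perm_eq c' E /\ cycle follows c'.
  by move/(_ (size E).+1 [::] E); apply.
elim=> // m IHm c r le_r pE cyc.
have bc := balanced_cycle cyc; have br := balanced_cat_cycle pE bE cyc.
have mem_sd b v : balanced b -> (v \in map s b) = (v \in map d b).
  move=> bb; rewrite -!has_pred1 !has_map !has_count.
  by congr (0 < _); rewrite (bb v).
case: r => [|g r] in le_r pE br *.
  by exists c; split; rewrite // perm_sym; rewrite cats0 in pE.
case: c => [|h c] in pE cyc bc *.
  have [p [r' [pr cp]]] := closed_trail br (mem_head g r).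
  apply: (IHm (g :: p) r') => //; last by rewrite (perm_trans pE).
  by have := perm_size pr; rewrite size_cat /= in le_r *; lia.
have [/hasP[f f_r /mapP[e e_c fe]]|/hasPn no_f] :=
    boolP (has (fun f => s f \in map s (h :: c)) (g :: r)); last first.
  suff inv : {in E, forall e, (s e \in map s (h :: c)) = (d e \in map s (h :: c))}.
    have := cE (fun v => v \in map s (h :: c)) inv h g.
    rewrite !(perm_mem pE) mem_head mem_cat mem_head orbT => /(_ isT isT).
    by move=> /(_ (map_f s (mem_head _ _))); rewrite (negPf (no_f g _)) ?mem_head.
  move=> e; rewrite (perm_mem pE) mem_cat => /orP[e_c|e_r].
    by rewrite [in RHS](mem_sd _ _ bc) !map_f.
  rewrite (negPf (no_f e e_r)); apply/esym/negbTE/mapP => -[f f_c de].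
  have : d e \in map s (g :: r) by rewrite mem_sd // map_f.
  case/mapP=> g' g'_r de'; have := no_f g' g'_r.
  by rewrite -de' de map_f.
have [p [r' [pr cp]]] := closed_trail br f_r.
case/rot_to: e_c => i q rot_c.
have perm_c : perm_eq (h :: c) (e :: q) by rewrite -rot_c perm_sym perm_rot.
apply: (IHm ((e :: q) ++ f :: p) r').
- by have := perm_size pr; rewrite size_cat /= in le_r *; lia.
- rewrite (perm_trans pE) // -catA; exact: perm_cat.
- by apply: cycle_splice; rewrite // -rot_c rot_cycle.
Qed.

End EulerCircuit.

(** * Farkas' lemma and clearing of denominators *)

Local Open Scope ring_scope.

(* Induction on the number of rows, after Bartl: if [x] separates [b] from all
   rows but the first row [a], with [a *m x > 0], project along [x] onto the
   hyperplane of vectors killed by [a]. *)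
Lemma farkas (F : realFieldType) m p (A : 'M[F]_(m, p)) (b : 'rV[F]_p) :
  (exists l : 'rV[F]_m, (forall i, 0 <= l 0 i) /\ b = l *m A) \/
  (exists y : 'cV[F]_p, (forall i, (A *m y) i 0 <= 0) /\ 0 < (b *m y) 0 0).
Proof.
elim: m A b => [|m IHm] A b.
  have [->|b_neq0] := eqVneq b 0.
    by left; exists 0; split=> [[]//|]; rewrite mul0mx.
  right; exists b^T; split=> [[]//|].
  have [j bj] : exists j, b 0 j != 0 by apply/rV0Pn.
  rewrite mxE (bigD1 j) //= mxE ltr_pwDl //.
    by rewrite -expr2 exprn_even_gt0.
  by apply: sumr_ge0 => i _; rewrite mxE -expr2 sqr_ge0.
rewrite -[m.+1]/(1 + m)%N in A *; rewrite -[A]vsubmxK.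
set a := usubmx A; set B := dsubmx A.
have [[l [l_ge0 ->]]|[x [Bx bx]]] := IHm B b.
  left; exists (row_mx 0 l); split; last by rewrite mul_row_col mul0mx add0r.
  move=> i; case: (split_ordP i) => j ->; last by rewrite row_mxEr.
  by rewrite row_mxEl mxE.
have [ax|ax] := leP ((a *m x) 0 0) 0.
  right; exists x; split=> // i; rewrite mul_col_mx.
  by case: (split_ordP i) => j ->; rewrite ?col_mxEu ?col_mxEd // ord1.
wlog ax1 : x Bx bx ax / (a *m x) 0 0 = 1.
  move=> /(_ (((a *m x) 0 0)^-1 *: x)); apply.
  - by move=> i; rewrite -scalemxAr mxE pmulr_rle0 ?invr_gt0.
  - by rewrite -scalemxAr mxE pmulr_rgt0 ?invr_gt0.
  - by rewrite -scalemxAr mxE mulVf ?gt_eqF.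
  - by rewrite -scalemxAr mxE mulVf ?gt_eqF.
have {}ax1 : a *m x = 1%:M by rewrite [LHS]mx11_scalar ax1.
have [[l [l_ge0 def_b]]|[y [By b_y]]] := IHm (B - B *m x *m a) (b - b *m x *m a).
  (* The weight of the row [a] is nonnegative: [b *m x] is positive, while [l] is nonnegative and
     [B *m x] nonpositive. *)
  left; exists (row_mx (b *m x - l *m (B *m x)) l); split; last first.
    rewrite mul_row_col mulmxBl -[LHS](subrK (b *m x *m a)) def_b mulmxBr.
    by rewrite !mulmxA [LHS]addrC addrA addrAC.
  move=> i; case: (split_ordP i) => j ->; last by rewrite row_mxEr.
  rewrite row_mxEl ord1 mxE [X in _ + X]mxE subr_ge0.
  rewrite (le_trans _ (ltW bx)) // mxE.
  by apply: sumr_le0 => k _; rewrite mulr_ge0_le0.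
right; exists (y - x *m (a *m y)); split; last first.
  by rewrite mulmxBr !mulmxA -[_ - _](mulmxBl b).
move=> i; rewrite mul_col_mx; case: (split_ordP i) => j ->.
  by rewrite col_mxEu mulmxBr !mulmxA ax1 mul1mx subrr mxE.
by rewrite col_mxEd mulmxBr !mulmxA -mulmxBl By.
Qed.

Lemma clear_denominators (I : finType) (r : I -> rat) : (forall i, 0 <= r i) ->
  exists N (k : I -> nat), (0 < N)%N /\ forall i, N%:R * r i = (k i)%:R.
Proof.
move=> r_ge0; exists (\prod_i `|denq (r i)|)%N.
suff /fin_all_exists[k def_k] : forall i, exists k : nat,
    (\prod_i `|denq (r i)|)%N%:R * r i = k%:R.
  by exists k; split=> //; apply: prodn_gt0 => i; rewrite absz_gt0 denq_neq0.
move=> i; rewrite (bigD1 i) //= natrM mulrAC; set N := (\prod_(_ | _) _)%N.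
exists (`|numq (r i)| * N)%N; rewrite natrM; congr (_ * _).
rewrite -[X in _ * X = _](divq_num_den (r i)) !pmulrn !abszE.
rewrite (gtr0_norm (denq_gt0 _)) ger0_norm ?numq_ge0 //.
by rewrite mulrCA mulfV ?mulr1 // intr_eq0 denq_neq0.
Qed.

(** * Integer relations between points, or supporting hyperplanes *)

Section Faces.
Variables (n m : nat) (vt : 'I_m -> 'rV[int]_n).

Definition mass (k : 'I_m -> nat) := (\sum_i k i)%N.
Definition chip_sum (k : 'I_m -> nat) := \sum_i vt i *+ k i.

(** The pair [y] stands for a half-space with normal [y.1] and bound [y.2]. The slack is nonnegative
    inside and zero on the bounding hyperplane. *)
Definition slack (y : 'rV[rat]_n * rat) i : rat :=
  y.2 - \sum_j y.1 0 j * (vt i 0 j)%:~R.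

Lemma slack_sum (J : finType) (P : pred J) (y : J -> 'rV[rat]_n * rat) i :
  slack (\sum_(u | P u) (y u).1, \sum_(u | P u) (y u).2) i =
  \sum_(u | P u) slack (y u) i.
Proof.
rewrite /slack /= sumrB exchange_big /=; congr (_ - _).
by apply: eq_bigr => j _; rewrite summxE mulr_suml.
Qed.

(* Farkas' lemma, homogenized: [v] lies in the smallest face containing [A], or
   a supporting hyperplane of all points contains [A] and avoids [v]. *)
Lemma relation_or_separation (A : {set 'I_m}) v :
  (exists p q, [/\ forall i, i \notin A -> p i = 0%N, (0 < q v)%N,
                   mass p = mass q & chip_sum p = chip_sum q]) \/
  (exists y, [/\ forall i, 0 <= slack y i, {in A, forall i, slack y i = 0} &
                 0 < slack y v]).
Proof.
(* The extra column of ones makes a relation between rows preserve the mass as well as the sum. *)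
pose G : 'M[rat]_(m, n + 1) :=
  row_mx (\matrix_(i, j) (vt i 0 j)%:~R) (const_mx 1).
pose D : 'M[rat]_m := diag_mx (\row_i (i \in A)%:R).
(* The cone is spanned by the rows in [A] and the negatives of all rows. If it contains row [v],
   moving the negatives to the other side gives a relation with [p'] supported on [A] and [q']
   positive at [v]. *)
have [[l [l_ge0]]|[y [y_le0 yv]]] := farkas (col_mx (D *m G) (- G)) (row v G).
  rewrite -[l]hsubmxK mul_row_col mulmxN mulmxA rowE => /eqP.
  rewrite eq_sym subr_eq => /eqP.
  rewrite -mulmxDl; set p' := _ *m D; set q' := _ + rsubmx l => pG_qG.
  pose r (x : 'I_m + 'I_m) := match x with inl i => p' 0 i | inr i => q' 0 i end.
  have [|N [k [N_gt0 def_k]]] := @clear_denominators _ r.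
    case=> i /=; first by rewrite /p' mul_mx_diag !mxE mulr_ge0 ?ler0n.
    by rewrite !mxE addr_ge0 ?ler0n.
  have eqG j : \sum_i (k (inl i))%:R * G i j = \sum_i (k (inr i))%:R * G i j.
    have /(congr1 (fun M : 'rV_(n + 1) => N%:R * M 0 j)) := pG_qG.
    rewrite !mxE !mulr_sumr => eq_r.
    transitivity (\sum_i N%:R * (p' 0 i * G i j)).
      by apply: eq_bigr => i _; rewrite mulrA (def_k (inl i)).
    by rewrite eq_r; apply: eq_bigr => i _; rewrite mulrA (def_k (inr i)).
  left; exists (k \o inl), (k \o inr); split=> [i i_A|||].
  - apply/eqP; rewrite -(eqr_nat rat) -(def_k (inl i)) /= /p' mul_mx_diag !mxE.
    by rewrite (negPf i_A) !mulr0.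
  - rewrite -(ltr0n rat) /= -(def_k (inr v)) mulr_gt0 ?ltr0n //= !mxE !eqxx.
    by rewrite ltr_wpDr.
  - apply/eqP; rewrite -(eqr_nat rat) !natr_sum; apply/eqP.
    have := eqG (rshift n 0); congr (_ = _).
      by apply: eq_bigr => i _; rewrite row_mxEr mxE mulr1.
    by apply: eq_bigr => i _; rewrite row_mxEr mxE mulr1.
  - apply/rowP => j; apply: (@intr_inj rat); rewrite !summxE !rmorph_sum /=.
    have := eqG (lshift 1 j); congr (_ = _).
      by apply: eq_bigr => i _; rewrite row_mxEl mxE mulmxnE rmorphMn mulr_natl.
    by apply: eq_bigr => i _; rewrite row_mxEl mxE mulmxnE rmorphMn mulr_natl.
(* With this sign the slack is [G *m y]. The block [- G] makes it nonnegative everywhere, and the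
   block [D *m G] then forces it to vanish on [A]. *)
right; exists (- (usubmx y)^T, dsubmx y 0 0).
have def_slack i : slack (- (usubmx y)^T, dsubmx y 0 0) i = (G *m y) i 0.
  rewrite /slack /= -[in RHS](vsubmxK y) mul_row_col [RHS]mxE addrC -sumrN.
  congr (_ + _); first by rewrite [RHS]mxE big_ord1 [const_mx 1 _ _]mxE mul1r.
  by rewrite [RHS]mxE; apply: eq_bigr => j _; rewrite !mxE mulNr opprK mulrC.
have Gy_ge0 i : 0 <= (G *m y) i 0.
  have := y_le0 (rshift m i).
  by rewrite mul_col_mx col_mxEd mulNmx [X in X <= _]mxE oppr_le0.
split=> [i|i i_A|]; rewrite def_slack //.
  apply: le_anti; rewrite Gy_ge0 andbT; have := y_le0 (lshift m i).
  by rewrite mul_col_mx col_mxEu -mulmxA mul_diag_mx !mxE i_A mul1r.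
by rewrite -row_mul mxE in yv.
Qed.

(** Without a relation reaching a new point, each [v] outside [A] has its own separating half-space.
    Their sum has slack zero exactly on [A]; points of [A] contribute the zero pair. *)
Lemma relation_or_face (A : {set 'I_m}) :
  (exists p q v, [/\ v \notin A, forall i, i \notin A -> p i = 0%N, (0 < q v)%N,
                   mass p = mass q & chip_sum p = chip_sum q]) \/
  (exists y, (forall i, 0 <= slack y i) /\ forall i, (slack y i == 0) = (i \in A)).
Proof.
have [[v [p [q [? [? ? ? ?]]]]]|no_rel] := EM (exists v p q, v \notin A /\
    [/\ forall i, i \notin A -> p i = 0%N, (0 < q v)%N,
                   mass p = mass q & chip_sum p = chip_sum q]).
  by left; exists p, q, v.
right; have /boolp.choice[y sep_y] : forall v, exists y,
    [/\ forall i, 0 <= slack y i, {in A, forall i, slack y i = 0} &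
        v \notin A -> 0 < slack y v].
  move=> v; have [v_A|v_A] := boolP (v \in A).
    have slack0 i : slack (0, 0) i = 0.
      by rewrite /slack big1 ?subrr // => j _; rewrite mxE mul0r.
    by exists (0, 0); split=> // i *; rewrite slack0.
  have [[p [q [? ? ? ?]]]|[y [? ? ?]]] := relation_or_separation A v.
    by case: no_rel; exists v, p, q.
  by exists y.
exists (\sum_(u | predT u) (y u).1, \sum_(u | predT u) (y u).2).
split=> i; rewrite slack_sum.
  by apply: sumr_ge0 => u _; have [] := sep_y u.
have [i_A|i_A] := boolP (i \in A).
  by rewrite big1 ?eqxx // => u _; have [_ s0 _] := sep_y u; apply: s0.
apply: gt_eqF; rewrite (bigD1 i) //= ltr_pwDl //.
  by case: (sep_y i) => _ _; apply.
by apply: sumr_ge0 => u _; have [] := sep_y u.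
Qed.

End Faces.

(** * Moving chips along edges and relations *)

Section Chips.
Variables (n m : nat) (vt : 'I_m -> 'rV[int]_n) (adj : rel 'I_m).
Local Notation chip_sum := (chip_sum vt).

Hypothesis accessible : forall (A : {set 'I_m}) y,
  A != finset.set0 -> A != [set: 'I_m]%SET -> (forall i, 0 <= slack vt y i) ->
  (forall i, (slack vt y i == 0) = (i \in A)) ->
  exists i j, [/\ i \in A, j \notin A & adj i j].

Hypothesis generating : forall z : 'rV[int]_n, exists s : seq ('I_m * 'I_m),
  all (fun ij => adj ij.1 ij.2) s /\ z = \sum_(ij <- s) (vt ij.2 - vt ij.1).

(** Such a [Q] plays the part of a union of connected components of the translated graph, whose
    vertices are the sums of [M] chips. *)
Definition move_invariant (M : nat) (Q : pred 'rV[int]_n) := forall (k : 'I_m -> nat) i j,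
  adj i j -> mass k = M -> (0 < k i)%N ->
  Q (chip_sum k + (vt j - vt i)) = Q (chip_sum k).

(** The truncated subtraction removes a chip only if [i] holds one, hence the hypothesis [0 < k i]
    below. *)
Definition transfer (k : 'I_m -> nat) i j l := (k l - (l == i) + (l == j))%N.

Lemma eq_chip_sum k k' : k =1 k' -> chip_sum k = chip_sum k'.
Proof. by move=> eq_k; apply: eq_bigr => i _; rewrite eq_k. Qed.

Lemma massD p q : mass (fun i : 'I_m => p i + q i)%N = (mass p + mass q)%N.
Proof. by rewrite /mass big_split. Qed.

Lemma chip_sumD p q : chip_sum (fun i => p i + q i)%N = chip_sum p + chip_sum q.
Proof. by rewrite -big_split; apply: eq_bigr => i _; rewrite mulrnDr. Qed.

Lemma mass_unit (i : 'I_m) : mass (fun l => nat_of_bool (l == i)) = 1%N.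
Proof. by rewrite /mass (bigD1 i) //= eqxx big1 ?addn0 // => l /negPf->. Qed.

Lemma chip_sum_unit i : chip_sum (fun l => nat_of_bool (l == i)) = vt i.
Proof.
rewrite /chip_sum (bigD1 i) //= eqxx big1 ?addr0 // => l /negPf->.
by rewrite mulr0n.
Qed.

Lemma transferE k i j l : (0 < k i)%N ->
  (transfer k i j l + (l == i) = k l + (l == j))%N.
Proof. by rewrite /transfer; have [->|_] := eqVneq l i; lia. Qed.

Lemma mass_transfer k i j : (0 < k i)%N -> mass (transfer k i j) = mass k.
Proof.
move=> ki; apply/eqP; rewrite -(eqn_add2r 1) -{1}(mass_unit i) -(mass_unit j).
by rewrite -!massD; apply/eqP/eq_bigr => l _; apply: transferE.
Qed.

Lemma chip_sum_transfer k i j :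
  (0 < k i)%N -> chip_sum (transfer k i j) = chip_sum k + (vt j - vt i).
Proof.
move=> ki; apply: (addIr (vt i)); rewrite addrA subrK -{1}(chip_sum_unit i).
by rewrite -(chip_sum_unit j) -!chip_sumD; apply: eq_chip_sum => l; apply: transferE.
Qed.

Section Invariant.
Variables (M : nat) (Q : pred 'rV[int]_n).
Hypothesis invQ : move_invariant M Q.

(** Each move takes at most one chip from a vertex, so [size s] chips everywhere allow the moves in
    any order, whether or not consecutive edges fit together. *)
Lemma invariant_path s k : all (fun ij => adj ij.1 ij.2) s -> mass k = M ->
  (forall i, size s <= k i)%N ->
  Q (chip_sum k + \sum_(ij <- s) (vt ij.2 - vt ij.1)) = Q (chip_sum k).
Proof.
elim: s k => [|[i j] s IHs] k /=; first by rewrite big_nil addr0.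
case/andP=> adj_ij adj_s totk ge_k.
have ki : (0 < k i)%N by apply: leq_trans (ge_k i).
rewrite big_cons addrA -chip_sum_transfer // IHs //.
- by rewrite chip_sum_transfer ?invQ.
- by rewrite mass_transfer.
- by move=> l; have := ge_k l; rewrite /transfer; lia.
Qed.

Lemma invariant_push t k i j : adj i j -> i != j -> mass k = M -> (t <= k i)%N ->
  exists k', [/\ mass k' = M, Q (chip_sum k') = Q (chip_sum k) &
    forall l, k' l = (if l == i then k i - t else if l == j then k j + t else k l)%N].
Proof.
move=> adj_ij ij totk; elim: t => [|t IHt] le_t.
  exists k; split=> // l; rewrite subn0 addn0.
  by case: eqP => [->|_] //; case: eqP => [->|_].
have [k' [totk' Qk' def_k']] := IHt (ltnW le_t).
have k'i : (0 < k' i)%N by rewrite def_k' eqxx subn_gt0.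
exists (transfer k' i j); split.
- by rewrite mass_transfer.
- by rewrite chip_sum_transfer // invQ.
- move=> l; rewrite /transfer def_k'; case: (eqVneq l i) => [->|_].
    by rewrite (negPf ij); lia.
  by case: eqP; lia.
Qed.

(** Carry chips one at a time from a vertex with surplus over [k'] to one with a deficit. The giver
    holds more than [k' i >= L] chips, so the bound [L] survives, and the total surplus drops. *)
Lemma invariant_heavy L :
  (forall i j k, mass k = M -> (forall l, L <= k l)%N ->
     Q (chip_sum k + (vt j - vt i)) = Q (chip_sum k)) ->
  forall k k', mass k = M -> mass k' = M ->
  (forall l, L <= k l)%N -> (forall l, L <= k' l)%N -> Q (chip_sum k) = Q (chip_sum k').
Proof.
move=> freeQ k k' totk totk' ge_k ge_k'.
have [d] := ubnP (\sum_l (k l - k' l))%N.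
elim: d k totk ge_k => // d IHd k totk ge_k lt_d.
have [/existsP[i lt_i]|/existsPn le_k] := boolP [exists i, k' i < k i]%N; last first.
  have {}le_k l : (k l <= k' l)%N by have := le_k l; rewrite -leqNgt.
  congr (Q _); apply: eq_chip_sum => l.
  have /leqif_sum[_] : forall i : 'I_m, true -> (k i <= k' i ?= iff (k i == k' i))%N.
    by move=> i _; split; rewrite ?le_k.
  by rewrite -[LHS]/(mass k == mass k') totk totk' eqxx => /esym/forallP/(_ l)/eqP.
have [j lt_j] : exists j, (k j < k' j)%N.
  apply/existsP; apply: contraLR (lt_i) => /existsPn ge_kk'.
  have {}ge_kk' l : (k' l <= k l)%N by have := ge_kk' l; rewrite -leqNgt.
  have /leqif_sum[_] : forall i : 'I_m, true -> (k' i <= k i ?= iff (k' i == k i))%N.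
    by move=> l _; split; rewrite ?ge_kk'.
  rewrite -[LHS]/(mass k' == mass k) totk totk' eqxx => /esym/forallP/(_ i)/eqP->.
  by rewrite ltnn.
have ki : (0 < k i)%N by lia.
rewrite -(freeQ i j) // -chip_sum_transfer // IHd ?mass_transfer //.
  by move=> l; rewrite /transfer; have := ge_k l; have := ge_k' i; case: eqP => [->|]; lia.
rewrite -ltnS (leq_trans _ lt_d) // ltnS [ltnRHS](bigD1 i) // [ltnLHS](bigD1 i) //=.
rewrite -addSn leq_add //.
  rewrite /transfer eqxx; case: eqP => [eij|]; [by move: lt_i lt_j; rewrite eij; lia | lia].
apply: leq_sum => l /negPf li; rewrite /transfer li.
by case: eqP => [->|]; lia.
Qed.

End Invariant.

(** Induction on the complement of [A], adding one vertex at a time. The threshold [T] is chosen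
    before [M], [Q] and [k], which lets [M] be defined from such thresholds later. *)
Lemma spread L (A : {set 'I_m}) : A != finset.set0 -> exists T, forall M Q k,
  move_invariant M Q -> mass k = M -> {in A, forall i, T <= k i}%N ->
  exists k', [/\ mass k' = M, forall i, (L <= k' i)%N & Q (chip_sum k') = Q (chip_sum k)].
Proof.
have [d] := ubnP #|~: A|; elim: d A => // d IHd A lt_d A_neq0.
have [->|AnT] := eqVneq A [set: 'I_m]%SET.
  by exists L => M Q k _ totk ge_k; exists k; split=> // i; apply: ge_k; rewrite inE.
have grow v : v \notin A -> exists T, forall M Q k,
  move_invariant M Q -> mass k = M -> {in v |: A, forall i, T <= k i}%N ->
  exists k', [/\ mass k' = M, forall i, (L <= k' i)%N & Q (chip_sum k') = Q (chip_sum k)].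
  move=> v_A; apply: IHd; last by apply/set0Pn; exists v; rewrite setU11.
  rewrite -ltnS (leq_trans _ lt_d) // ltnS proper_card // properC.
  by rewrite properE finset.subsetUr; apply/subsetPn; exists v; rewrite ?setU11.
have [[p [q [v [v_A p0 qv tot_pq pt_pq]]]]|[y [y_ge0 y_A]]] := relation_or_face vt A.
  (* The relation is applied [T] times: [v] gains at least [T] chips, and a vertex of [A] loses at
     most [T * mass p], keeping [T]. *)
  have [T spreadT] := grow v v_A; exists (T + T * mass p)%N.
  move=> M Q k invQ totk ge_k.
  pose k' l := (k l - T * p l + T * q l)%N.
  have le_p l : (T * p l <= k l)%N.
    have [l_A|/p0->] := boolP (l \in A); last by rewrite muln0.
    apply: leq_trans (ge_k l l_A); rewrite (leq_trans _ (leq_addl _ _)) //.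
    by rewrite leq_mul2l /mass (bigD1 l) // leq_addr orbT.
  have k'E l : (k' l + T * p l = k l + T * q l)%N by rewrite /k'; have := le_p l; lia.
  have totM r : mass (fun l => T * r l)%N = (T * mass r)%N.
    by rewrite /mass big_distrr.
  have ptM r : chip_sum (fun l => T * r l)%N = chip_sum r *+ T.
    by rewrite /chip_sum -sumrMnl; apply: eq_bigr => l _; rewrite mulnC mulrnA.
  have totk' : mass k' = M.
    apply/eqP; rewrite -(eqn_add2r (T * mass p)) -totM -massD -totk.
    rewrite [X in (_ + X)%N]totM tot_pq -totM -massD.
    by apply/eqP/eq_bigr => l _; apply: k'E.
  have ptk' : chip_sum k' = chip_sum k.
    apply: (addIr (chip_sum p *+ T)); rewrite -ptM -chip_sumD [in RHS]ptM pt_pq -ptM -chip_sumD.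
    exact: eq_chip_sum.
  have [|k2 [? ? Qk2]] := spreadT M Q k' invQ totk'; last first.
    by exists k2; split; rewrite // Qk2 ptk'.
  move=> l; rewrite !inE => /predU1P[->|l_A].
    by rewrite /k' (leq_trans _ (leq_addl _ _)) // leq_pmulr.
  have le_pl : (p l <= mass p)%N by rewrite /mass (bigD1 l) // leq_addr.
  have := leq_mul (leqnn T) le_pl; have := ge_k l l_A; rewrite /k'; lia.
have [i [j [i_A j_A adj_ij]]] := accessible A_neq0 AnT y_ge0 y_A.
(* Half of the chips on [i] are pushed to [j] and [T] remain. *)
have [T spreadT] := grow j j_A; exists (T + T)%N => M Q k invQ totk ge_k.
have ij : i != j by apply: contraNneq j_A => <-.
have le_T : (T <= k i)%N by have := ge_k i i_A; lia.
have [k' [totk' Qk' def_k']] := invariant_push invQ adj_ij ij totk le_T.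
have [|k2 [? ? Qk2]] := spreadT M Q k' invQ totk'; last first.
  by exists k2; split; rewrite // Qk2 Qk'.
move=> l; rewrite !inE def_k' => /predU1P[->|l_A].
  by rewrite eq_sym (negPf ij) eqxx leq_addl.
have := ge_k l l_A; have := ge_k i i_A.
by case: eqP => [_|_]; [lia | case: eqP => [->|_]; lia].
Qed.

Theorem move_invariant_constant : (0 < m)%N -> exists2 M, (0 < M)%N &
  forall Q k k', move_invariant M Q -> mass k = M -> mass k' = M ->
    Q (chip_sum k) = Q (chip_sum k').
Proof.
move=> m_gt0.
have /boolp.choice[s s_path] : forall ij : 'I_m * 'I_m, exists s : seq ('I_m * 'I_m),
    all (fun ij => adj ij.1 ij.2) s /\
    vt ij.2 - vt ij.1 = \sum_(ij <- s) (vt ij.2 - vt ij.1).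
  by move=> ij; apply: generating.
(* With [L] chips everywhere, any difference of two vertices can be realized by moves. *)
pose L := (\max_ij size (s ij))%N.
have /boolp.choice[T spreadT] : forall v : 'I_m, exists T, forall M Q k,
    move_invariant M Q -> mass k = M -> (T <= k v)%N -> exists k',
    [/\ mass k' = M, forall i, (L <= k' i)%N & Q (chip_sum k') = Q (chip_sum k)].
  move=> v; have [|T spreadT] := @spread L [set v]%SET.
    by apply/set0Pn; exists v; rewrite inE.
  exists T => M Q k invQ totk le_T; apply: spreadT => // i.
  by rewrite inE => /eqP->.
(* Pigeonhole: with [M] chips, some vertex [v] holds at least [T v]. *)
pose M := (\sum_v (T v).+1)%N; exists M.
  by rewrite /M (bigD1 (Ordinal m_gt0)).
move=> Q k k' invQ totk totk'.
have heavy k1 : mass k1 = M -> exists k2,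
    [/\ mass k2 = M, forall i, (L <= k2 i)%N & Q (chip_sum k2) = Q (chip_sum k1)].
  move=> tot1; suff [v le_v] : exists v, (T v <= k1 v)%N by apply: (spreadT v).
  apply/existsP; apply: contraLR (leqnn M) => /existsPn lt_T.
  rewrite -ltnNge -{1}tot1 -[ltnRHS]/M.
  have lt_all v : (k1 v < (T v).+1)%N by rewrite ltnS ltnW // ltnNge lt_T.
  have [i0] : exists i : 'I_m, true by exists (Ordinal m_gt0).
  move=> _; rewrite /mass /M (bigD1 i0) //= [ltnRHS](bigD1 i0) //= -addSn.
  by rewrite leq_add ?lt_all // leq_sum // => v _; rewrite ltnW ?lt_all.
have [k1 [tot1 ge1 <-]] := heavy k totk.
have [k2 [tot2 ge2 <-]] := heavy k' totk'.
apply: (invariant_heavy (M := M) (L := L)) => // i j k3 tot3 ge3.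
have [s_adj /= ->] := s_path (i, j).
apply: (invariant_path invQ) => // l; apply: leq_trans (ge3 l).
exact: (leq_bigmax (i, j)).
Qed.

End Chips.

(** * The union of translates: balance, accessibility, connectedness *)

Section Translates.
Variables (n K : nat) (a : 'I_K -> 'rV[int]_n) (E : seq (edge n K)).

Lemma symmetric_union_translates zs :
  symmetric_graph a E -> symmetric_graph a (union_translates E zs).
Proof.
move=> symE v; elim: zs => // z zs IHzs.
rewrite /union_translates /= !count_cat [X in (_ + X)%N]IHzs; congr (_ + _)%N.
rewrite !count_map -[in LHS](subrK z v) -[in RHS](subrK z v).
under eq_count => e do rewrite /= /src /= (inj_eq (addIr z)).
under [in RHS]eq_count => e do rewrite /= /dst /= addrAC (inj_eq (addIr z)).
exact: symE.
Qed.

Local Notation V := (vertices a E).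
Definition vertex (i : 'I_(size V)) : 'rV[int]_n := nth 0 V i.

Definition adjacent : rel 'I_(size V) :=
  fun i j => has (fun e => (src e == vertex i) && (dst a e == vertex j)) E.

Lemma vertexP v : v \in V -> exists i, vertex i = v.
Proof.
move=> v_V; have lt_v : (index v V < size V)%N by rewrite index_mem.
by exists (Ordinal lt_v); rewrite /vertex nth_index.
Qed.

Lemma src_vertex e : e \in E -> exists i, vertex i = src e.
Proof. by move=> e_E; apply: vertexP; rewrite mem_undup mem_cat map_f. Qed.

Lemma dst_vertex e : e \in E -> exists i, vertex i = dst a e.
Proof. by move=> e_E; apply: vertexP; rewrite mem_undup mem_cat map_f ?orbT. Qed.

Lemma vertices_gt0 e : e \in E -> (0 < size V)%N.
Proof. by case/src_vertex=> i _; apply: leq_ltn_trans (ltn_ord i). Qed.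

Lemma generating_adjacent : Zn_generating a E -> forall z : 'rV[int]_n,
  exists s, all (fun ij => adjacent ij.1 ij.2) s /\
            z = \sum_(ij <- s) (vertex ij.2 - vertex ij.1).
Proof.
move=> genE z; have [s [_ /allP s_E ->]] := genE z.
elim: s s_E => [|e s IHs] s_E; first by exists [::]; rewrite !big_nil.
have [f f_s|s' [adj_s' def_s']] := IHs; first by apply: s_E; rewrite inE f_s orbT.
have e_E : e \in E by apply: s_E; rewrite mem_head.
have [i def_i] := src_vertex e_E; have [j def_j] := dst_vertex e_E.
exists ((i, j) :: s'); rewrite !big_cons def_s' /= def_i def_j; split=> //.
by rewrite adj_s' andbT; apply/hasP; exists e; rewrite // def_i def_j !eqxx.
Qed.

Section Accessible.
Variable R : realType.

Lemma dotR_sum (I : finType) (c : 'rV[R]_n) (w : I -> R) (x : I -> 'rV[R]_n) :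
  dotR c (\sum_i w i *: x i) = \sum_i w i * dotR c (x i).
Proof.
rewrite /dotR; under [RHS]eq_bigr do rewrite mulr_sumr.
rewrite exchange_big /=; apply: eq_bigr => j _.
by rewrite summxE mulr_sumr; apply: eq_bigr => i _; rewrite mxE mulrCA.
Qed.

Lemma vertex_conv_hull i : @conv_hull n R V (toR R (vertex i)).
Proof.
exists (fun j => (j == i)%:R); split=> [j||].
- exact: ler0n.
- by rewrite (bigD1 i) //= eqxx big1 ?addr0 // => j /negPf->.
- rewrite (bigD1 i) //= eqxx scale1r big1 ?addr0 // => j /negPf->.
  by rewrite scale0r.
Qed.

Lemma dotR_vertex (y : 'rV[rat]_n * rat) i :
  dotR (map_mx ratr y.1) (toR R (vertex i)) = ratr y.2 - ratr (slack vertex y i).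
Proof.
rewrite -rmorphB /= /slack opprB addrCA subrr addr0 rmorph_sum.
by apply: eq_bigr => j _; rewrite !mxE rmorphM /= ratr_int.
Qed.

(** The rational half-space, read over [R], cuts out a face of the hull whose graph vertices are
    exactly those of [A]. It is strict because [A] misses a vertex, so an edge leaves it. *)
Lemma accessible_adjacent : face_accessible a R E ->
  forall (A : {set 'I_(size V)}) y,
  A != finset.set0 -> A != [set: 'I_(size V)]%SET ->
  (forall i, 0 <= slack vertex y i) ->
  (forall i, (slack vertex y i == 0) = (i \in A)) ->
  exists i j, [/\ i \in A, j \notin A & adjacent i j].
Proof.
move=> accE A y /set0Pn[i0 i0_A] AnT y_ge0 y_A.
pose C := @conv_hull n R V; pose c : 'rV[R]_n := map_mx ratr y.1.
pose F := (C `&` [set x | dotR c x = ratr y.2])%classic.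
have F_vertex i : F (toR R (vertex i)) <-> i \in A.
  rewrite -y_A; split=> [[_ /=]|/eqP y_i].
    rewrite dotR_vertex => /eqP; rewrite subr_eq addrC -subr_eq0 opprD.
    by rewrite addrC subrK oppr_eq0 fmorph_eq0.
  by split; [exact: vertex_conv_hull | rewrite /= dotR_vertex y_i rmorph0 subr0].
have F_face : is_face C F.
  exists c, (ratr y.2); split=> // x [w [w_ge0 w_sum ->]].
  rewrite dotR_sum -[leRHS]mul1r -w_sum mulr_suml; apply: ler_sum => i _.
  rewrite ler_wpM2l // -[nth 0 V i]/(vertex i) dotR_vertex gerBl ler0q.
  exact: y_ge0.
have [||e e_E [Fs Fd]] := accE F F_face.
- by exists (toR R (vertex i0)); apply/F_vertex.
- move=> FC; case/negP: AnT; apply/eqP/setP => i; rewrite inE.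
  by apply/F_vertex; rewrite FC; apply: vertex_conv_hull.
have [i def_i] := src_vertex e_E; have [j def_j] := dst_vertex e_E.
exists i, j; split.
- by apply/F_vertex; rewrite def_i.
- by apply/negP => /F_vertex; rewrite def_j.
- by apply/hasP; exists e; rewrite // def_i def_j !eqxx.
Qed.

End Accessible.

(** Configurations of mass [N] have entries at most [N], so finite functions into ['I_N.+1]
    enumerate them all. Equal sums are kept with multiplicity. *)
Definition chip_sums N : seq 'rV[int]_n :=
  map (fun k : {ffun 'I_(size V) -> 'I_N.+1} => chip_sum vertex (fun i => k i : nat))
      [seq k : {ffun 'I_(size V) -> 'I_N.+1} <- enum {: {ffun 'I_(size V) -> 'I_N.+1}} |
        mass (fun i => k i : nat) == N].

Lemma chip_sumsP N z :
  reflect (exists2 k, mass k = N & z = chip_sum vertex k) (z \in chip_sums N).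
Proof.
apply: (iffP mapP) => [[k]|[k massk ->]].
  by rewrite mem_filter => /andP[/eqP massk _] ->; exists (fun i => k i : nat).
have lt_k i : (k i < N.+1)%N by rewrite ltnS -massk /mass (bigD1 i) // leq_addr.
pose k' : {ffun 'I_(size V) -> 'I_N.+1} := [ffun i => Ordinal (lt_k i)].
have k'E i : k i = k' i by rewrite ffunE.
exists k'; last exact: eq_chip_sum.
rewrite mem_filter mem_enum andbT; apply/eqP; rewrite -[RHS]massk.
by apply: eq_bigr => i _; rewrite k'E.
Qed.

(** Of [N.+1] chips, one sits at the source of an edge of [E] and the other [N] give the
    translation. Following the translated edge moves that chip, so a predicate constant along edges
    is move invariant. *)
Lemma connected_union_chip_sums N :
  (forall Q k k', move_invariant vertex adjacent N.+1 Q -> mass k = N.+1 ->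
     mass k' = N.+1 -> Q (chip_sum vertex k) = Q (chip_sum vertex k')) ->
  weakly_connected (@src n K) (dst a) (union_translates E (chip_sums N)).
Proof.
move=> constQ P invP.
have srcP e : e \in union_translates E (chip_sums N) ->
    exists2 k, mass k = N.+1 & src e = chip_sum vertex k.
  case/flatten_mapP=> z /chip_sumsP[k massk ->] /mapP[f f_E ->].
  have [i def_i] := src_vertex f_E.
  exists (fun l => (k l + (l == i))%N).
    by rewrite massD massk mass_unit addn1.
  by rewrite chip_sumD chip_sum_unit /src /= def_i addrC.
move=> e f /srcP[k massk ->] /srcP[k' massk' ->].
rewrite (constQ P k k') // => {e f massk massk'} {}k i j /hasP[e e_E].
case/andP=> /eqP src_e /eqP dst_e massk ki.
(* The [N] chips left after removing the one at [i]; their sum is the translation vector. *)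
pose k1 l := (k l - (l == i))%N.
have k1E l : k l = (k1 l + (l == i))%N.
  by rewrite /k1; case: eqP => [->|]; lia.
have chipk : chip_sum vertex k = chip_sum vertex k1 + vertex i.
  by rewrite (eq_chip_sum _ k1E) chip_sumD chip_sum_unit.
have massk1 : mass k1 = N.
  have : mass k = (mass k1 + mass (fun l => nat_of_bool (l == i)))%N.
    by rewrite -massD; apply: eq_bigr => l _.
  by rewrite massk mass_unit addn1 => -[].
pose z := chip_sum vertex k1.
have /invP : (src e + z, lbl e) \in union_translates E (chip_sums N).
  apply/flatten_mapP; exists z; first by apply/chip_sumsP; exists k1.
  by apply/mapP; exists e.
have -> : chip_sum vertex k + (vertex j - vertex i) = dst a (src e + z, lbl e).
  by rewrite chipk [vertex j - _]addrC addrA addrK -dst_e addrA [z + _]addrC.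
have -> : chip_sum vertex k = src (src e + z, lbl e) by rewrite chipk addrC src_e.
by [].
Qed.

End Translates.

Theorem mainTheorem5 (R : realType) (n K : nat) (a : 'I_K -> 'rV[int]_n)
    (E : seq (edge n K)) :
  symmetric_graph a E -> face_accessible a R E -> Zn_generating a E ->
  exists zs : seq 'rV[int]_n, zs != [::] /\ eulerian a (union_translates E zs).
Proof.
move=> symE accE genE.
(* Even the zero vector must be a nonempty sum of edge vectors. *)
have [e e_E] : exists e, e \in E.
  have [[|e s] [//= _ /andP[e_E _] _]] := genE 0.
  by exists e.
have V_gt0 := vertices_gt0 a e_E.
have [[//|N] _ constQ] := move_invariant_constant
  (accessible_adjacent accE) (generating_adjacent genE) V_gt0.
exists (chip_sums a E N); split; last first.
  apply: euler_circuit; first exact: symmetric_union_translates.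
  exact: connected_union_chip_sums.
(* Placing all [N] chips on one vertex shows that there is at least one translate. *)
have : chip_sum (@vertex _ _ a E) (fun i => N * (i == Ordinal V_gt0))%N
    \in chip_sums a E N.
  apply/chip_sumsP; exists (fun i => N * (i == Ordinal V_gt0))%N => //.
  by rewrite /mass -big_distrr /= [X in (_ * X)%N]mass_unit muln1.
by case: chip_sums.
Qed.
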